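(* Let $(\mathfrak{g},\bullet)$ be a left Leibniz algebra and let $K$ be the symmetric bilinear form $K(u,v)=-\tfrac12\left(\mathrm{tr}(\mathrm{L}_u\circ\mathrm{R}_v)+\mathrm{tr}(\mathrm{L}_v\circ\mathrm{R}_u)\right)$ on $\mathfrak{g}$. 1. $\mathfrak{g}$ is semi-simple if and only if $\ker K=\mathrm{Leib}(\mathfrak{g})$. 2. $\mathfrak{g}$ is solvable if and only if $\mathfrak{g}\bullet\mathfrak{g}\subset\ker K$.
   Context: Algebras are real and finite dimensional. For $u\in\mathfrak{g}$, $\mathrm{L}_u(v)=u\bullet v$ and $\mathrm{R}_u(v)=v\bullet u$. $(\mathfrak{g},\bullet)$ is a left Leibniz algebra if $u\bullet(v\bullet w)=(u\bullet v)\bullet w+v\bullet(u\bullet w)$ for all $u,v,w$. $\mathrm{Leib}(\mathfrak{g})=\mathrm{span}\{u\bullet v+v\bullet u: u,v\in\mathfrak{g}\}$. For subspaces $F,G$, $F\bullet G$ is the span of the products $u\bullet v$, $u\in F,v\in G$. $\mathfrak{g}$ is solvable if the derived series $\mathfrak{g}^{(1)}=\mathfrak{g}$, $\mathfrak{g}^{(n+1)}=\mathfrak{g}^{(n)}\bullet\mathfrak{g}^{(n)}$ reaches $\{0\}$. The radical of $\mathfrak{g}$ is its largest solvable ideal, and $\mathfrak{g}$ is semi-simple if its radical equals $\mathrm{Leib}(\mathfrak{g})$ (equivalently, the Lie algebra $\mathfrak{g}/\mathrm{Leib}(\mathfrak{g})$ is semi-simple). $\ker K=\{x: K(x,\cdot)=0\}$.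 *)

(* Defs.v *)
From HB Require Import structures.
From mathcomp Require Import all_boot all_order all_algebra.
From mathcomp Require Import boolp classical_sets reals.

Set Implicit Arguments.
Unset Strict Implicit.
Unset Printing Implicit Defensive.

Import GRing.Theory.
Local Open Scope classical_set_scope.
Local Open Scope ring_scope.

Section Span.
Variables (R : realType) (V : vectType R).
Implicit Types (S : set V) (U W : {vspace V}).

Definition is_span S U : Prop :=
  S `<=` [set` U] /\ (forall W, S `<=` [set` W] -> (U <= W)%VS).

(* The library's [span] is restricted to finite sequences; here S is arbitrary.
   The default value of [xget] is never used, by [set_spanP]. *)
Definition set_span S : {vspace V} := xget 0%VS (is_span S).

Lemma exists_max_subspace (P : {vspace V} -> Prop) U0 : P U0 ->
  exists2 U, P U & forall W, P W -> (U <= W)%VS -> W = U.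
Proof.
move: {2}(\dim {:V} - \dim U0)%N (leqnn (\dim {:V} - \dim U0)%N) => n.
elim: n U0 => [|n IHn] U0 len PU0.
  exists U0 => // W _ sUW; apply/eqP; rewrite eq_sym eqEdim sUW.
  rewrite (leq_trans (dimvS (subvf W))) //.
  by rewrite -subn_eq0 -leqn0.
case: (pselect (forall W, P W -> (U0 <= W)%VS -> W = U0)) => [maxU|].
  by exists U0.
move=> /existsNP [W] /not_implyP [PW] /not_implyP [sUW neqWU].
apply: (IHn W) => //.
have ltd : (\dim U0 < \dim W)%N.
  rewrite ltnNge; apply/negP => leWU; apply: neqWU.
  by apply/eqP; rewrite eq_sym eqEdim sUW.
by rewrite -ltnS (leq_trans _ len) // ltn_sub2l // (leq_trans ltd) // dimvS // subvf.
Qed.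

Lemma set_span_seq S :
  exists2 s : seq V, (forall x, x \in s -> S x) & is_span S <<s>>%VS.
Proof.
pose P U := exists2 s : seq V, (forall x, x \in s -> S x) & U = <<s>>%VS.
have [|_ [s sS ->] maxs] := @exists_max_subspace P <<[::]>>%VS.
  by exists [::].
exists s => //; split=> [x Sx /=|W SW]; last first.
  by apply/span_subvP => x /sS /SW.
rewrite -(maxs <<x :: s>>%VS) ?memv_span ?mem_head //.
  by exists (x :: s) => // y; rewrite in_cons => /predU1P [-> //|/sS].
by apply: sub_span => y ys; rewrite in_cons ys orbT.
Qed.

Lemma set_spanP S : is_span S (set_span S).
Proof. by apply: (@xgetPex _ 0%VS (is_span S)); case: (set_span_seq S) => s _ ?; exists <<s>>%VS. Qed.

Lemma mem_set_span S x :
  x \in set_span S <->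
  exists2 s : seq V, (forall y, y \in s -> S y) & x \in <<s>>%VS.
Proof.
have [subS minS] := set_spanP S; split=> [xS|[s sS]].
  have [s sS [subs mins]] := set_span_seq S.
  by exists s => //; apply: subvP xS; apply: minS.
by apply: subvP x; apply/span_subvP => y /sS /subS.
Qed.

End Span.

Section Algebra.
Variables (R : realType) (g : vectType R) (mul : {bilinear g -> g -> g}).
Implicit Types (u v w : g) (F G I J : {vspace g}).

Definition left_leibniz : Prop :=
  forall u v w, mul u (mul v w) = mul (mul u v) w + mul v (mul u w).

Definition Lmul u : 'End(g) := linfun (mul u).
Definition Rmul u : 'End(g) := linfun (applyr mul u).

Lemma LmulE u v : Lmul u v = mul u v. Proof. by rewrite lfunE. Qed.
Lemma RmulE u v : Rmul u v = mul v u. Proof. by rewrite lfunE. Qed.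

Definition lftrace (f : 'End(g)) : R :=
  \tr (passmx.mxof (vbasis {:g}) (vbasis {:g}) f).

Definition Leib : {vspace g} :=
  set_span [set x | exists u v, x = mul u v + mul v u].

Definition prod_space F G : {vspace g} :=
  set_span [set x | exists u v, [/\ u \in F, v \in G & x = mul u v]].

(* Indexed from 0, so that [derived I n] is I^(n+1). *)
Fixpoint derived I (n : nat) : {vspace g} :=
  if n is m.+1 then prod_space (derived I m) (derived I m) else I.

Definition solvable I : Prop := exists n, derived I n = 0%VS.

Definition ideal I : Prop :=
  forall u v, v \in I -> mul u v \in I /\ mul v u \in I.

Definition is_radical I : Prop :=
  [/\ ideal I, solvable I
    & forall J, ideal J -> solvable J -> (J <= I)%VS].

(* The default value of [xget] is never used, by [radicalP]. *)
Definition radical : {vspace g} := xget 0%VS is_radical.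

Definition semisimple : Prop := radical = Leib.

Definition leibK u v : R :=
  - 2^-1 * (lftrace (Lmul u \o Rmul v)%VF + lftrace (Lmul v \o Rmul u)%VF).

Definition kerK : set g := [set x | forall y, leibK x y = 0].

Lemma prod_space_subP F G U :
  (prod_space F G <= U)%VS <->
  (forall u v, u \in F -> v \in G -> mul u v \in U).
Proof.
have [sub min] := set_spanP [set x | exists u v, [/\ u \in F, v \in G & x = mul u v]].
split=> [/subvP sU u v uF vG|H].
  by apply: sU; apply: sub; exists u, v.
by apply: min => _ [u [v [uF vG ->]]]; apply: H.
Qed.

Lemma mem_prod_space F G u v : u \in F -> v \in G -> mul u v \in prod_space F G.
Proof. exact: ((prod_space_subP F G _).1 (subvv _)). Qed.

Lemma derivedS I J n : (I <= J)%VS -> (derived I n <= derived J n)%VS.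
Proof.
move=> sIJ; elim: n => //= n /subvP IHn; apply/prod_space_subP => u v uI vI.
by rewrite mem_prod_space // IHn.
Qed.

Lemma derived_add I m n : derived I (m + n) = derived (derived I n) m.
Proof. by elim: m => //= m ->. Qed.

Lemma solvable_addv I J :
  ideal J -> solvable I -> solvable J -> solvable (I + J)%VS.
Proof.
move=> idJ [n In0] [m Jm0]; exists (m + n)%N; rewrite derived_add.
suff /(derivedS m): (derived (I + J) n <= J)%VS.
  by rewrite Jm0 subv0 => /eqP.
rewrite -[J in X in (_ <= X)%VS]add0v -In0.
elim: n {In0} => //= n /subvP IHn; apply/prod_space_subP => u v.
move=> /IHn/memv_addP [a aI [b bJ ->]] /IHn/memv_addP [c cI [d dJ ->]].

rewrite linearDl linearDr -addrA memv_add ?mem_prod_space //.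
rewrite memvD ?memvD //; first exact: (idJ _ _ dJ).1.
by rewrite linearDr memvD //; [exact: (idJ _ _ bJ).2 | exact: (idJ _ _ bJ).2].
Qed.

Lemma ideal_addv I J : ideal I -> ideal J -> ideal (I + J)%VS.
Proof.
move=> idI idJ u _ /memv_addP [a /(idI u) [a1 a2] [b /(idJ u) [b1 b2] ->]].
by rewrite linearDl linearDr !memv_add.
Qed.

Lemma radicalP : is_radical radical.
Proof.
apply: (@xgetPex _ 0%VS is_radical).
have [|I [idI solI] maxI] := @exists_max_subspace _ g
    (fun I => ideal I /\ solvable I) 0%VS.
  split; last by exists 0%N.
  by move=> u v; rewrite memv0 => /eqP ->; rewrite linear0l linear0r mem0v.
exists I; split=> // J idJ solJ.
rewrite -(maxI (I + J)%VS) ?addvSl ?addvSr //.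
by split; [exact: ideal_addv | exact: solvable_addv].
Qed.

Lemma radical_eq I : is_radical I -> radical = I.
Proof.
case: radicalP => idr solr maxr [idI solI maxI].
by apply/eqP; rewrite eqEsubv maxI // maxr.
Qed.

Lemma leibKC u v : leibK u v = leibK v u.
Proof. by rewrite /leibK addrC. Qed.

End Algebra.

(* Main.v *)
Require Import Defs.
From HB Require Import structures.
From mathcomp Require Import all_boot all_order all_algebra all_field.
From mathcomp Require Import complex ring lra.
From mathcomp Require Import boolp classical_sets reals.

(** Left multiplication by an element of Leib vanishes, and left multiplications
    preserve Leib, so [u |-> L_u] induces a representation on [g / Leib]: it is
    the adjoint representation of that Lie algebra, pulled back to [g]
    ([mxad], [mxad_mul]).  Since [R_v] kills Leib and [R_v = - L_v] modulo Leib,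
    the trace of [L_u R_v] is minus the trace of [ad u ad v] on [g / Leib]:
    the form [K] is the Killing form of [g / Leib] pulled back to [g]
    ([mxtrace_mxad]).  The kernel of [mxad] consists of the [u] with
    [u g <= Leib], and [Leib Leib = 0], so solvability of a subalgebra of [g] is
    the same as solvability of its image.  The proposition thus amounts to
    Cartan's criterion for a Lie algebra [X] of matrices ([cartan_criterion]):
    [X] is solvable if and only if [tr ([x, y] z) = 0] for all [x, y, z] in [X].

    For the second part of the proposition, apply the criterion to the image
    of [g].  For the first part, the kernel of [K] is an ideal on which [K]
    vanishes, hence a solvable ideal; so it is in the radical.  Conversely, let
    [J] be a solvable ideal not contained in Leib and [A] its last derived ideal
    not contained in Leib.  Then [A A <= Leib], so [ad a ad x] has square zero
    for [a] in [A], and [A] lies in the kernel of [K]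
    ([mxad_abelian_trace0], [solvable_ideal_sub]).

    Both directions of Cartan's criterion end with Engel's theorem ([engel]),
    which states that a Lie algebra of nilpotent elements of a
    finite-dimensional associative algebra has a vanishing power.

    If all [tr ([x, y] z)] vanish, then the elements of [[X, X]] are nilpotent
    ([commv_nilpotent]).  This is Chevalley's argument: over the complex
    numbers, let [y] act on each generalized eigenspace of [x] as the conjugate
    of the eigenvalue.  The adjoint action of [y] is a polynomial without
    constant term in the adjoint action of [x] ([exists_conjugate_part]), so
    [y] normalizes whatever [x] does; this gives [tr (x y) = 0] for [x] in
    [[X, X]], while [tr (x y)] is the sum of the squared moduli of the
    eigenvalues of [x].  Engel's theorem then makes [[X, X]] nilpotent.

    If [X] is solvable, then each of its derived algebras from the first one on
    is trace-orthogonal to the associative algebra generated by [X]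
    ([trace_orth_dercommv]).  This is proved from the last derived algebra
    upwards: by invariance of the trace, orthogonality of the next terms forces
    the traces of all powers of an element to vanish, so the element is
    nilpotent, and Engel's theorem turns this into a nilpotent ideal of the
    associative algebra ([trace_orth_ideal]). *)

Set Implicit Arguments.
Unset Strict Implicit.
Unset Printing Implicit Defensive.

Import Order.TTheory GRing.Theory Num.Theory.
Local Open Scope ring_scope.

(** * Traces of idempotent and nilpotent matrices *)

Section MatrixTraces.
Variable F : numFieldType.

(** A factorization [E = B A] through the rank turns [E E = E] into [A B = 1],
    and [tr (B A) = tr (A B)]. *)
Lemma mxtrace_idem n (E : 'M[F]_n) : E *m E = E -> \tr E = (\rank E)%:R.
Proof.
move=> EE.
have [C'] := row_fullP (col_base_full E).
have /row_freeP[R'] := row_base_free E; have := mulmx_base E.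
move: (row_base E) (col_base E) C' R'; move: (\rank E) => r A B C' R' defE AR' C'B.
have AB : A *m B = 1%:M.
  move: EE; rewrite -defE => /(congr1 (fun M => C' *m M *m R')).
  by rewrite !mulmxA C'B mul1mx -!(mulmxA _ _ R') AR' !mulmx1.
by rewrite -{1}defE mxtrace_mulC AB mxtrace1.
Qed.

(** A nilpotent [x] is not invertible, so a full-rank factorization [x = B A]
    replaces it by the smaller nilpotent matrix [A B] of the same trace. *)
Lemma mxtrace_nilpotent n (x : 'M[F]_n) m : x ^+ m = 0 -> \tr x = 0.
Proof.
elim/ltn_ind: n x m => n IHn x m xm0.
have [|ltrn] := eqVneq (\rank x) n.
  move=> /eqP rx.
  have /row_freeP [y xy] : row_free x by [].
  suff xmU k : exists z, x ^+ k *m z = 1%:M.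
    have [z] := xmU m; rewrite xm0 mul0mx => /(congr1 (mulmx x)).
    by rewrite mulmx0 mulmx1 => <-; rewrite mxtrace0.
  elim: k => [|k [z xz]]; first by exists 1%:M; rewrite mul1mx.
  by exists (y *m z); rewrite exprSr -mulmxE -mulmxA (mulmxA x) xy mul1mx.
have := mulmx_base x; move: (rank_leq_row x) ltrn (row_base x) (col_base x).
move: (\rank x) => r ler neqr A B defx.
rewrite -defx mxtrace_mulC; apply: (IHn _ _ _ m.+1).
  by rewrite ltn_neqAle neqr.
suff -> : (A *m B) ^+ m.+1 = A *m x ^+ m *m B by rewrite xm0 mulmx0 mul0mx.
elim: m {xm0} => [|m IHm]; first by rewrite expr1 mulmx1.
by rewrite exprSr IHm exprSr -!mulmxE -{3}defx !mulmxA.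
Qed.

(** Write the characteristic polynomial as [q 'X^m] with [q] prime to ['X].  The
    Fitting idempotent [e], which projects onto the part where [x] is
    invertible, is a polynomial in [x] without constant term.  Its trace, which
    is its rank, thus vanishes. *)
Lemma nilpotent_mxtraceX n (x : 'M[F]_n.+1) :
  (forall k, \tr (x ^+ k.+1) = 0) -> x ^+ n.+1 = 0.
Proof.
move=> trx.
have tr_hornerX (p : {poly F}) : \tr (horner_mx x (p * 'X)) = 0.
  rewrite -[p]coefK poly_def mulr_suml rmorph_sum raddf_sum big1 // => i _ /=.
  by rewrite -scalerAl -exprSr linearZ /= rmorphXn /= horner_mx_X mxtraceZ trx mulr0.
have [m [q [rq def_q]]] :
    exists m, exists q, ~~ root q 0 /\ char_poly x = q * 'X^m.
  have [m [q rq def_q]] := multiplicity_XsubC (char_poly x) 0.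
  rewrite monic_neq0 ?char_poly_monic //= in rq.
  by exists m, q; rewrite rq def_q subr0.
have le_mn : (m <= n.+1)%N.
  have q0 : q != 0 by apply: contraNneq rq => ->; rewrite root0.
  have := size_char_poly x; rewrite def_q size_mulXn // => eqn.
  by rewrite -ltnS -eqn -[X in (X < _)%N]addn0 ltn_add2l size_poly_gt0.
have cop : coprimep 'X^(n.+1) q.
  by rewrite coprimep_expl // -['X]subr0 -polyC0 coprimep_sym coprimep_XsubC.
have /Bezout_eq1_coprimepP [[u v] /= uv1] := cop.
pose e := horner_mx x (u * 'X^(n.+1)).
have qX0 : horner_mx x (q * 'X^(n.+1)) = 0.
  rewrite -(subnK le_mn) addnC exprD mulrA -def_q rmorphM /=.
  by rewrite Cayley_Hamilton mul0r.
have ee : e * e = e.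
  have eh : e * horner_mx x (v * q) = 0.
    by rewrite -rmorphM mulrACA [_ * q]mulrC rmorphM /= qX0 mulr0.
  by rewrite -[RHS]mulr1 -(rmorph1 (horner_mx x)) -uv1 rmorphD mulrDr eh addr0.
have e0 : e = 0.
  apply/eqP; rewrite -mxrank_eq0 -(pnatr_eq0 F) -mxtrace_idem //.
  by rewrite /e exprSr mulrA tr_hornerX.
have : horner_mx x ('X^(n.+1) * 1) = x ^+ n.+1.
  by rewrite mulr1 rmorphXn /= horner_mx_X.
rewrite -uv1 mulrDr rmorphD /= rmorphM /= -/e e0 mulr0 add0r.
by rewrite mulrCA rmorphM /= [_ * q]mulrC qX0 mulr0.
Qed.

End MatrixTraces.

(** * The conjugate of the semisimple part of a complex matrix *)

Section Interpolation.
Variable F : fieldType.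
Implicit Types (a b : F) (s : seq F) (p q : {poly F}).

Lemma coprimep_prod_XsubC N s a : a \notin s ->
  coprimep ((\prod_(b <- s) ('X - b%:P)) ^+ N) (('X - a%:P) ^+ N).
Proof.
move=> sa; apply: coprimep_expl; apply: coprimep_expr.
by rewrite coprimep_XsubC root_prod_XsubC.
Qed.

Lemma dvdp_prod_XsubCX N s p : uniq s ->
  {in s, forall b, ('X - b%:P) ^+ N %| p} ->
  (\prod_(b <- s) ('X - b%:P)) ^+ N %| p.
Proof.
elim: s => [|a s IHs] /=; first by rewrite big_nil expr1n dvd1p.
case/andP=> sa us sp; rewrite big_cons exprMn mulrC.
rewrite Gauss_dvdp ?coprimep_prod_XsubC // sp ?mem_head // andbT.
by apply: IHs => // b bs; apply: sp; rewrite in_cons bs orbT.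
Qed.

(** Chinese remainder theorem for the pairwise coprime [('X - a) ^+ N]. *)
Lemma interpolation_XsubCX N s (f : F -> F) : uniq s ->
  exists q, {in s, forall a, ('X - a%:P) ^+ N %| q - (f a)%:P}.
Proof.
elim: s => [|a s IHs] /=; first by exists 0.
case/andP=> sa /IHs [q sq].
have /Bezout_eq1_coprimepP [[u v] /= uv1] := coprimep_prod_XsubC N sa.
set P := (\prod_(b <- s) _) ^+ N in uv1.
exists (q + P * (u * ((f a)%:P - q))) => b; rewrite in_cons.
case: eqVneq => [-> _|_ /= bs]; last first.
  rewrite addrAC dvdp_add ?sq // dvdp_mulr // dvdp_exp2r //.
  by rewrite dvdp_XsubCl root_prod_XsubC.
have -> : q + P * (u * ((f a)%:P - q)) - (f a)%:P
          = (1 - u * P) * (q - (f a)%:P) by ring.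
by rewrite -{1}uv1 addrAC subrr add0r mulrAC dvdp_mull.
Qed.

End Interpolation.

Section Spectral.
Variables (C : closedFieldType) (n : nat) (x : 'M[C]_n.+1).

(** The exponent [n.+1] bounds the multiplicity of every root of the
    characteristic polynomial, to which Cayley-Hamilton applies. *)
Lemma horner_mx_eq0_XsubC : exists2 s : seq C, uniq s &
  forall p, {in s, forall a, ('X - a%:P) ^+ n.+1 %| p} -> horner_mx x p = 0.
Proof.
have [r] := closed_field_poly_normal (char_poly x).
rewrite (monicP (char_poly_monic x)) scale1r => def_r.
exists (undup r) => [|p sp]; first exact: undup_uniq.
suff /dvdpP [q ->] : char_poly x %| p.
  by rewrite rmorphM /= Cayley_Hamilton mulr0.
apply: dvdp_trans (dvdp_prod_XsubCX (undup_uniq r) sp).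
have szr : (size r <= n.+1)%N.
  by rewrite -ltnS -(size_prod_XsubC r id) -def_r size_char_poly.
rewrite def_r -prodr_undup_exp_count -prodrXl.
elim/big_ind2: _ => [|? ? ? ?|a _] //; first exact: dvdp_mul.
by apply: dvdp_exp2l; apply: leq_trans szr; apply: count_size.
Qed.

(** The polynomials [e a] represent the projections onto the generalized
    eigenspaces of [x]. *)
Lemma spectral_idempotents : exists s : seq C, exists e : C -> {poly C},
  [/\ uniq s,
      \sum_(a <- s) horner_mx x (e a) = 1,
      {in s, forall a, horner_mx x (e a * ('X - a%:P) ^+ n.+1) = 0} &
      {in s, forall a, horner_mx x (e a) * horner_mx x (e a) = horner_mx x (e a)}].
Proof.
have [s us vanish] := horner_mx_eq0_XsubC.
(* [e a] interpolates the indicator function of [a]. *)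
have /choice [e e_s] a := interpolation_XsubCX n.+1 (fun b => (b == a)%:R) us.
have e_diff a b : a != b -> b \in s -> ('X - b%:P) ^+ n.+1 %| e a.
  by move=> neqab /e_s - /(_ a); rewrite eq_sym (negPf neqab) subr0.
exists s, e; split=> // [|a sa|a sa].
- apply/eqP; rewrite -subr_eq0 -rmorph_sum -(rmorph1 (horner_mx x)) -rmorphB.
  apply/eqP/vanish => b bs.
  rewrite (bigD1_seq b) //= addrAC dvdp_add //.
    by have := e_s b b bs; rewrite eqxx.
  by elim/big_ind: _ => [|? ?|a ?]; [exact: dvdp0|exact: dvdp_add|exact: e_diff].
- apply: vanish => b bs; have [->|neqab] := eqVneq a b; first exact: dvdp_mull.
  by rewrite dvdp_mulr ?e_diff.
- apply/eqP; rewrite -subr_eq0 -{3}[horner_mx x _]mulr1 -mulrBr.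
  rewrite -(rmorph1 (horner_mx x)) -rmorphB -rmorphM.
  apply/eqP/vanish => b bs; have [<-|neqab] := eqVneq a b.
    by rewrite dvdp_mull //; have := e_s a a sa; rewrite eqxx.
  by rewrite dvdp_mulr ?e_diff.
Qed.

End Spectral.

Section ConjugatePart.
Variables (C : numClosedFieldType) (n : nat) (x : 'M[C]_n.+1).
Import FalgLfun.

Let M := 'M[C]_n.+1.
Let ad : 'End(M) := amull x - amulr x.

Let adE d : ad d = x * d - d * x.
Proof. by rewrite add_lfunE opp_lfunE !lfunE. Qed.

Let hornerX_eigen (f : 'End(M)) (c k : C) N q (d : M) :
  ((f - c%:A) ^+ N) d = 0 -> ('X - c%:P) ^+ N %| q - k%:P ->
  horner_alg f q d = k *: d.
Proof.
move=> fNd /dvdpP [p def_q].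
have -> : q = k%:P + ('X - c%:P) ^+ N * p by rewrite mulrC -def_q addrC subrK.
rewrite rmorphD rmorphM rmorphXn /= rmorphB /= horner_algX !horner_algC.
rewrite add_lfunE scale_lfunE id_lfunE.
by rewrite lfun_mulE fNd linear0 addr0.
Qed.

(** Left multiplication by [x - a] and right multiplication by [x - b] commute,
    and their difference is [ad - (a - b)]; after [N + N] steps one of them has
    been applied [N] times. *)
Let ad_eigen (a b : C) d (N := n.+1) :
  (x - a%:M) ^+ N * d = 0 -> d * (x - b%:M) ^+ N = 0 ->
  ((ad - (a - b)%:A) ^+ (N + N)) d = 0.
Proof.
move=> xad dbx.
suff H k i j : (N + N <= k + i + j)%N ->
    ((ad - (a - b)%:A) ^+ k) ((x - a%:M) ^+ i * d * (x - b%:M) ^+ j) = 0.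
  by have := H (N + N)%N 0%N 0%N; rewrite !addn0 !expr0 mul1r mulr1; apply.
elim: k i j => [|k IHk] i j leN.
  rewrite expr0 id_lfunE.
  have [leNi|ltiN] := leqP N i.
    by rewrite -(subnK leNi) exprD -!mulrA (mulrA _ d) [_ * d]xad mul0r mulr0.
  have leNj : (N <= j)%N.
    by rewrite -(leq_add2l N) (leq_trans leN) // add0n leq_add2r ltnW.
  by rewrite -(subnKC leNj) exprD -!mulrA (mulrA d) dbx mul0r mulr0.
have step z : (ad - (a - b)%:A) z = (x - a%:M) * z - z * (x - b%:M).
  rewrite add_lfunE opp_lfunE scale_lfunE id_lfunE adE mulrBl mulrBr.
  rewrite -!mulmxE mul_scalar_mx mul_mx_scalar scalerBl opprB opprB.
  by rewrite addrACA [RHS]addrACA; congr (_ + _); rewrite addrC.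
rewrite exprS lfun_mulE step linearB /= !mulrA -exprS -(mulrA _ _ (x - b%:M)) -exprSr.
by rewrite !IHk ?subr0 // ?addnS -?addSn // addSnnS.
Qed.

(** The matrix [y] is [q(x)] with [q] congruent to the conjugate of [a] modulo
    ['X - a] to a high power, for every eigenvalue [a] of [x].  As conjugation
    is additive, the differences [a - b] are also sent to their conjugates, so
    that [ad y] is [p(ad x)] with [p] interpolating conjugation at these
    differences; one of them is [0], whence [p] has no constant term and [ad y]
    maps [B] to [A] as soon as [ad x] does.  Finally [tr (x y)] is the sum of
    the squared moduli of the eigenvalues of [x], with multiplicities. *)
Lemma exists_conjugate_part : exists2 y : M,
  forall A B : {vspace M}, (A <= B)%VS ->
    {in B, forall b, x * b - b * x \in A} -> {in B, forall b, y * b - b * y \in A}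
  & \tr (x * y) = 0 -> x ^+ n.+1 = 0.
Proof.
have [s [e [us e1 ex ee]]] := spectral_idempotents x.
pose E a := horner_mx x (e a).
have xE a : a \in s -> (x - a%:M) ^+ n.+1 * E a = 0.
  move=> /ex; rewrite mulrC rmorphM rmorphXn /= rmorphB /= horner_mx_X.
  by rewrite horner_mx_C.
have Ex a : a \in s -> E a * (x - a%:M) ^+ n.+1 = 0.
  move=> /ex; rewrite rmorphM rmorphXn /= rmorphB /= horner_mx_X.
  by rewrite horner_mx_C.
have [q qs] := interpolation_XsubCX n.+1 (fun a => a^* : C) us.
pose t := undup [seq a - b | a <- s, b <- s].
have [p pt] := interpolation_XsubCX (n.+1 + n.+1) (fun a => a^* : C) (undup_uniq _ : uniq t).
have t_sub a b : a \in s -> b \in s -> a - b \in t.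
  by move=> sa sb; rewrite mem_undup; apply/allpairsP; exists (a, b).
set y := horner_mx x q.
have yE a : a \in s -> y * E a = a^* *: E a.
  move=> sa; have /dvdpP [r def_r] := qs a sa.
  have -> : y = horner_mx x (r * ('X - a%:P) ^+ n.+1) + (a^*)%:M.
    by rewrite -def_r rmorphB /= horner_mx_C subrK.
  rewrite rmorphM rmorphXn /= rmorphB /= horner_mx_X horner_mx_C mulrDl -mulrA.
  by rewrite xE // mulr0 add0r -mulmxE mul_scalar_mx.
have Ey a : E a * y = y * E a by rewrite /y /E -!rmorphM mulrC.
have comm_xE a : x * E a = E a * x.
  by rewrite -[x](horner_mx_X x) /E -!rmorphM mulrC.
(* It is enough to compare both sides on the blocks [E a * d * E b], which are
   eigenvectors for each of them. *)
have ad_y d : y * d - d * y = horner_alg ad p d.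
  have {1 2 3}-> : d = \sum_(a <- s) \sum_(b <- s) E a * d * E b.
    under eq_bigr do rewrite -mulr_sumr e1 mulr1.
    by rewrite -mulr_suml e1 mul1r.
  rewrite mulr_sumr mulr_suml -sumrB [RHS]linear_sum; apply: eq_big_seq => a sa.
  rewrite mulr_sumr mulr_suml -sumrB [RHS]linear_sum; apply: eq_big_seq => b sb.
  rewrite /= (hornerX_eigen _ (pt (a - b) (t_sub _ _ sa sb))).
    rewrite !mulrA yE // -!mulrA Ey yE // -!scalerAl -!scalerAr.
    by rewrite -scalerBl rmorphB.
  by apply: ad_eigen; [rewrite !mulrA xE ?mul0r|rewrite -!mulrA Ex ?mulr0].
have xEa_nil a : a \in s -> ((x - a%:M) * E a) ^+ n.+1 = 0.
  move=> sa; rewrite exprMn_comm; last first.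
    by rewrite /GRing.comm mulrBl mulrBr -!mulmxE mul_scalar_mx mul_mx_scalar !mulmxE comm_xE.
  by rewrite (exprS (E a)) mulrA xE ?mul0r.
exists y => [A B sAB xBA b bB|].
  (* [p] vanishes at [0 = a - a]. *)
  have [p' def_p] : exists p', p = p' * 'X.
    case: (s) e1 t_sub => [|a s'] e1 t_sub.
      by move/eqP: e1; rewrite big_nil eq_sym oner_eq0.
    have := pt _ (t_sub a a (mem_head _ _) (mem_head _ _)).
    rewrite subrr conjC0 !subr0 addnS => /dvdpP [r ->].
    by exists (r * 'X ^+ (n.+1 + n)); rewrite -mulrA -exprSr.
  rewrite ad_y def_p [_ * 'X]mulrC rmorphM /= horner_algX lfun_mulE.
  have : ad b \in A by rewrite adE xBA.
  elim/poly_ind: p' (ad b) {def_p} => [|p' k IHp] d dA.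
    by rewrite rmorph0 zero_lfunE mem0v.
  rewrite rmorphD rmorphM /= horner_algX horner_algC add_lfunE scale_lfunE id_lfunE.
  rewrite lfun_mulE memvD ?memvZ //.
  by rewrite adE xBA // (subvP sAB) ?IHp.
have -> : \tr (x * y) = \sum_(a <- s) `|a| ^+ 2 * (\rank (E a))%:R.
  rewrite -[x * y]mulr1 -e1 mulr_sumr raddf_sum; apply: eq_big_seq => a sa /=.
  rewrite -mulrA yE // -scalerAr -(subrK a%:M x) mulrDl scalerDr mxtraceD mxtraceZ.
  rewrite (mxtrace_nilpotent (xEa_nil a sa)) mulr0 add0r -mulmxE mul_scalar_mx.
  by rewrite !mxtraceZ (mxtrace_idem (ee a sa)) mulrA normCK [_^* * _]mulrC.
have pos a : 0 <= `|a| ^+ 2 * (\rank (E a))%:R :> C.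
  by rewrite mulr_ge0 ?ler0n // exprn_ge0.
move=> /eqP; rewrite psumr_eq0 => [/allP s0|//].
rewrite -[x ^+ _]mulr1 -e1 mulr_sumr big_seq big1 // => a sa; rewrite -/(E a).
move: (s0 a sa); rewrite mulf_eq0 expf_eq0 normr_eq0 /= pnatr_eq0 mxrank_eq0.
case/orP=> /eqP; last by move=> ->; rewrite mulr0.
by move=> a0; have := xE a sa; rewrite a0 raddf0 subr0.
Qed.

End ConjugatePart.

(** * Commutators and Engel's theorem *)

Definition commutator (A : pzRingType) (x y : A) := x * y - y * x.

Section CommutatorTheory.
Variables (K : comNzRingType) (A : algType K).
Implicit Types (x y z : A).

Lemma commutatorDl x y z : commutator (x + y) z = commutator x z + commutator y z.
Proof. by rewrite /commutator mulrDl mulrDr opprD addrACA. Qed.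

Lemma commutatorN x y : commutator x y = - commutator y x.
Proof. by rewrite /commutator opprB. Qed.

Lemma commutatorDr x y z : commutator z (x + y) = commutator z x + commutator z y.
Proof. by rewrite commutatorN commutatorDl opprD -!commutatorN. Qed.

Lemma commutatorZl a x y : commutator (a *: x) y = a *: commutator x y.
Proof. by rewrite /commutator -scalerAl -scalerAr scalerBr. Qed.

Lemma commutatorZr a x y : commutator x (a *: y) = a *: commutator x y.
Proof. by rewrite commutatorN commutatorZl -scalerN -commutatorN. Qed.

Lemma commutatorxx x : commutator x x = 0.
Proof. by rewrite /commutator subrr. Qed.

Lemma commutatorMr x y z :
  commutator x (y * z) = commutator x y * z + y * commutator x z.
Proof. by rewrite /commutator mulrBl mulrBr !mulrA addrA subrK. Qed.

Lemma commutator_jacobi x y z : commutator x (commutator y z)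
  = commutator (commutator x y) z + commutator y (commutator x z).
Proof.
rewrite {2}/commutator commutatorDr -scaleN1r commutatorZr scaleN1r !commutatorMr.
by rewrite [_ * y + _]addrC opprD addrACA.
Qed.

End CommutatorTheory.

Section Engel.
Variables (K : fieldType) (A : falgType K).
Implicit Types (x y s t : A) (S T N X : {vspace A}).

Definition normalized_by X N := {in X & N, forall x y, commutator x y \in N}.

(** Elements of [agenv X] can be moved to the right past [N], at the cost of
    commutators that stay in [N]: hence [N * agenv X] is a two-sided ideal of
    [agenv X], whose powers are controlled by the powers of [N]. *)
Lemma normalized_agenv X N : normalized_by X N ->
  (agenv X * (N * agenv X) <= N * agenv X)%VS.
Proof.
move=> nXN; apply: agenv_modl; rewrite prodvA.
rewrite (subv_trans (prodvSl _ (_ : _ <= N * agenv X)%VS)) //; last first.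
  by rewrite -prodvA agenvM.
apply/prodvP => x v Xx Nv; rewrite -[x * v](subrK (v * x)) memvD //.
  rewrite -[_ - _]mulr1 memv_mul ?nXN //.
  by rewrite (subvP (sub1_agenv X)) ?memv_line.
by rewrite memv_mul // (subvP (sub_agenv X)).
Qed.

Lemma expv_normalized X N k : normalized_by X N ->
  ((N * agenv X) ^+ k <= N ^+ k * agenv X)%VS.
Proof.
move=> nXN; elim: k => [|k IHk]; first by rewrite !expv0 prod1v sub1_agenv.
rewrite !expvSr (subv_trans (prodvSl _ IHk)) // -!prodvA prodvSr //.
exact: normalized_agenv.
Qed.

Let expv_eq0_ge T m k : (T ^+ m = 0)%VS -> (m <= k)%N -> (T ^+ k = 0)%VS.
Proof. by move=> Tm0 /subnK <-; rewrite expvD Tm0 prodv0. Qed.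

(** The iterated commutators [[.. [s, t1], .. tk]] lie in the sum of the
    [T ^+ i * <[s]> * T ^+ j] with [i + j = k], which is [0] for [k] large as
    [T] is nilpotent.  So bracketing an element outside [T] with elements of [T]
    cannot go on for ever without falling in [T]; the last term outside [T]
    normalizes [T]. *)
Lemma exists_normalizer S T m : normalized_by S S -> (T <= S)%VS ->
  (T ^+ m = 0)%VS -> ~~ (S <= T)%VS ->
  exists s, [/\ s \in S, s \notin T & {in T, forall t, commutator s t \in T}].
Proof.
move=> lieS /subvP sTS Tm0 /subvPn [s0 Ss0 T's0].
apply: contrapT => no_s.
(* [G k] contains the [k]-fold brackets of [s0] with elements of [T]. *)
pose G := fix G k := if k is k.+1 then (T * G k + G k * T)%VS else <[s0]>%VS.
have G0 k i j : (m + m <= k + i + j)%N -> (T ^+ i * G k * T ^+ j = 0)%VS.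
  elim: k i j => [|k IHk] i j le_m /=.
    have [lemi|ltim] := leqP m i; first by rewrite (expv_eq0_ge Tm0 lemi) !prod0v.
    rewrite (@expv_eq0_ge T m j) ?prodv0 //.
    by rewrite -(leq_add2l m) (leq_trans le_m) // add0n leq_add2r ltnW.
  rewrite prodvDr prodvDl !prodvA -expvSr -(prodvA _ T) -expvSl.
  by rewrite !IHk ?addv0 // ?addnS -?addSn // addSnnS.
have chain k : exists s, [/\ s \in S, s \notin T & s \in G k].
  elim: k => [|k [s [Ss T's Gs]]]; first by exists s0; rewrite memv_line.
  have [t Tt T'st] : exists2 t, t \in T & commutator s t \notin T.
    apply: contrapT => no_t; apply: no_s; exists s; split=> // t Tt.
    by apply/negPn/negP => T'st; apply: no_t; exists t.
  exists (commutator s t); split=> //; first exact: lieS (sTS _ Tt).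
  by rewrite /commutator addrC memv_add ?memvN ?memv_mul.
have [s [_ T's Gs]] := chain (m + m)%N; case/negP: T's; move: Gs.
have := G0 (m + m)%N 0%N 0%N; rewrite !addn0 expv0 prod1v prodv1 => -> //.
by rewrite memv0 => /eqP ->; rewrite mem0v.
Qed.

Lemma normalized_add_line T s : normalized_by T T ->
  {in T, forall t, commutator s t \in T} ->
  {in (T + <[s]>)%VS &, forall x y, commutator x y \in T}.
Proof.
move=> lieT sT x y /memv_addP [t Tt [_ /vlineP [a ->] ->]].
case/memv_addP => [u Tu [_ /vlineP [b ->] ->]].
rewrite commutatorDl !commutatorDr !commutatorZl !commutatorZr commutatorxx.
rewrite !scaler0 addr0 (commutatorN t s).
by rewrite (memvD (memvD (lieT _ _ Tt Tu) _)) ?memvZ ?memvN ?sT.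
Qed.

(** Modulo the ideal generated by [T], which is nilpotent, the powers of
    [T + <[s]>] are those of [s]. *)
Lemma expv_add_line_eq0 T s m k : {in T, forall t, commutator s t \in T} ->
  normalized_by T T -> (T ^+ m = 0)%VS -> s ^+ k = 0 ->
  ((T + <[s]>) ^+ (k * m) = 0)%VS.
Proof.
move=> sT lieT Tm0 sk0; set X := (T + <[s]>)%VS; pose I := (T * agenv X)%VS.
have sTX : (T <= agenv X)%VS := subv_trans (addvSl _ _) (sub_agenv X).
have sX : s \in agenv X.
  by rewrite (subvP (sub_agenv X)) // (subvP (addvSr _ _)) ?memv_line.
have nXT : normalized_by X T.
  by move=> x t Xx Tt; rewrite (normalized_add_line lieT sT) // (subvP (addvSl _ _)).
have powX j : (X ^+ j <= <[s ^+ j]> + I)%VS.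
  elim: j => [|j IHj]; first by rewrite expv0 addvSl.
  rewrite expvSl (subv_trans (prodvSr _ IHj)) // prodvDl !prodvDr prodv_line -exprS.
  have Gs : (agenv X * I <= I)%VS by apply: normalized_agenv.
  rewrite !subv_add addvSl !(subv_trans _ (addvSr _ I)) //.
  - by apply: subv_trans Gs; apply: prodvSl; rewrite -memvE.
  - by apply: subv_trans Gs; apply: prodvSl.
  - apply: prodvSr; rewrite -expv_line.
    by apply: subv_trans (subX_agenv _ j); apply: expvS; apply: addvSr.
apply/eqP; rewrite -subv0 expvM.
have /expvS : (X ^+ k <= I)%VS by rewrite (subv_trans (powX k)) // sk0 add0v.
move=> /(_ m) /subv_trans; apply.
by rewrite (subv_trans (expv_normalized _ nXT)) // Tm0 prod0v.
Qed.

(** Jacobson's proof: a Lie subalgebra [T] of [S] with a vanishing power that is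
    maximal for these properties is [S], since otherwise adding an element of
    [S] that normalizes [T] would give a larger one. *)
Theorem engel S : normalized_by S S ->
  {in S, forall x, exists m, x ^+ m = 0} -> exists m, (S ^+ m = 0)%VS.
Proof.
move=> lieS nilS.
have step d : exists T, [/\ (T <= S)%VS, normalized_by T T,
    exists m, (T ^+ m = 0)%VS & (S <= T)%VS \/ (d <= \dim T)%N].
  elim: d => [|d [T [sTS lieT [m Tm0] dimT]]].
    exists 0%VS; split; [exact: sub0v| |by exists 1%N; rewrite expv1|by right].
    by move=> x y; rewrite !memv0 /commutator => /eqP -> /eqP ->; rewrite !mul0r subrr.
  have [sST|nsST] := boolP (S <= T)%VS.
    by exists T; split=> //; [exists m|left].
  have [s [Ss T's sT]] := exists_normalizer lieS sTS Tm0 nsST.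
  have [k sk0] := nilS s Ss.
  exists (T + <[s]>)%VS; split.
  - by rewrite subv_add sTS -memvE.
  - move=> x y xX yX; apply: (subvP (addvSl _ _)); exact: (normalized_add_line lieT sT).
  - by exists (k * m)%N; apply: expv_add_line_eq0.
  - right; case: dimT => [/(negP nsST)//|led].
    rewrite (leq_ltn_trans led) // ltnNge; apply: contra T's => ledim.
    have /eqP -> : T == (T + <[s]>)%VS by rewrite eqEdim addvSl.
    by rewrite (subvP (addvSr _ _)) ?memv_line.
have [T [sTS _ [m Tm0] [sST|]]] := step (\dim S).+1.
  by exists m; rewrite -Tm0; congr (_ ^+ _)%VS; apply/eqP; rewrite eqEsubv sTS sST.
by rewrite ltnNge dimvS.
Qed.

End Engel.

(** * Derived series and trace orthogonality *)

Lemma span_ind (K : fieldType) (V : vectType K) (P : V -> Prop) (s : seq V) : P 0 ->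
  (forall a x y, P x -> P y -> P (a *: x + y)) ->
  {in s, forall x, P x} -> {in <<s>>%VS, forall z, P z}.
Proof.
move=> P0 Plin Ps z; rewrite -[s]/(in_tuple s : seq V) => /coord_span ->.
elim/big_rec: _ => // i y _; apply: Plin.
by apply: Ps; rewrite mem_nth.
Qed.

Section CommutatorSpace.
Variables (K : fieldType) (A : falgType K).
Implicit Types (x y z : A) (X Y N U : {vspace A}).

Definition commv X Y : {vspace A} :=
  <<[seq commutator x y | x <- vbasis X, y <- vbasis Y]>>%VS.

Lemma memv_commv X Y : {in X & Y, forall x y, commutator x y \in commv X Y}.
Proof.
move=> x y /coord_vbasis -> /coord_vbasis ->.
have sumDl I r (F : I -> A) z : commutator (\sum_(i <- r) F i) z
    = \sum_(i <- r) commutator (F i) z.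
  by rewrite /commutator mulr_suml mulr_sumr -sumrB.
rewrite sumDl memv_suml // => i _; rewrite commutatorN sumDl memvN memv_suml // => j _.
rewrite commutatorN memvN commutatorZl commutatorZr !memvZ // memv_span //.
by apply/allpairsP; exists ((vbasis X)`_i, (vbasis Y)`_j); rewrite !mem_nth ?size_tuple.
Qed.

Lemma commv_subP X Y U :
  {in X & Y, forall x y, commutator x y \in U} <-> (commv X Y <= U)%VS.
Proof.
split=> [XYU|/subvP sU x y Xx Yy]; last by rewrite sU ?memv_commv.
by apply/span_subvP => _ /allpairsP [[x y] [/= /vbasis_mem Xx /vbasis_mem Yy ->]]; apply: XYU.
Qed.

Lemma commv_ind (P : A -> Prop) X Y : P 0 ->
  (forall a x y, P x -> P y -> P (a *: x + y)) ->
  {in X & Y, forall x y, P (commutator x y)} ->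
  {in commv X Y, forall z, P z}.
Proof.
move=> P0 Plin Pcomm; apply: span_ind => // z.
by case/allpairsP=> [[x y] [/= /vbasis_mem Xx /vbasis_mem Yy ->]]; apply: Pcomm.
Qed.

Lemma commv0 : commv 0 0 = 0%VS.
Proof.
apply/eqP; rewrite -subv0; apply/commv_subP => x y.
by rewrite !memv0 => /eqP -> _; rewrite /commutator mul0r mulr0 subrr.
Qed.

Lemma commvS X1 X2 Y1 Y2 : (X1 <= X2)%VS -> (Y1 <= Y2)%VS ->
  (commv X1 Y1 <= commv X2 Y2)%VS.
Proof.
move=> /subvP sX /subvP sY; apply/commv_subP => x y Xx Yy.
by rewrite memv_commv ?sX ?sY.
Qed.

Lemma commv_normalized X N : normalized_by X N -> normalized_by X (commv N N).
Proof.
move=> nXN x z Xx; move: z.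
apply: (@commv_ind (fun z => commutator x z \in commv N N))
  => [|a y z yN zN|y z Ny Nz].
- by rewrite /commutator mulr0 mul0r subrr mem0v.
- by rewrite commutatorDr commutatorZr memvD ?memvZ.
- by rewrite commutator_jacobi; apply: memvD; apply: memv_commv => //; apply: nXN.
Qed.

Fixpoint dercommv X k : {vspace A} :=
  if k is k.+1 then commv (dercommv X k) (dercommv X k) else X.

Lemma dercommv_normalized X k : normalized_by X X -> normalized_by X (dercommv X k).
Proof. by move=> lieX; elim: k => //= k; apply: commv_normalized. Qed.

Lemma dercommv_sub X k : normalized_by X X -> (dercommv X k <= X)%VS.
Proof.
move=> lieX; elim: k => //= k /subvP IHk; apply/commv_subP => x y Dx Dy.
by apply: lieX; apply: IHk.
Qed.

Lemma dercommv_sub_expv X k : normalized_by X X -> (dercommv X k.+1 <= commv X X ^+ k.+1)%VS.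
Proof.
move=> lieX; elim: k => // k /subvP IHk; apply/commv_subP => x y Dx Dy.
have sD1 : {subset dercommv X k.+1 <= commv X X}.
  by apply/subvP; apply: commvS; apply: dercommv_sub.
rewrite /commutator memvB // [(_ ^+ _)%VS]expvSl memv_mul ?IHk //; exact: sD1.
Qed.

End CommutatorSpace.

Section SolvableTrace.
Variables (F : numFieldType) (n : nat).
Let M := 'M[F]_n.+1.
Implicit Types (x y z w : M) (X Y H : {vspace M}).

Definition trace_orth X z := {in agenv X, forall w, \tr (z * w) = 0}.

Lemma mxtrace_commutator x y w : \tr (commutator x y * w) = \tr (x * commutator y w).
Proof.
rewrite /commutator mulrBl mulrBr !linearB /= !mulrA; congr (_ - _).
by rewrite -(mulrA y) -!mulmxE mxtrace_mulC.
Qed.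

Let memvXn X h k : h \in agenv X -> h ^+ k \in agenv X.
Proof.
move=> Xh; elim: k => [|k IHk]; last by rewrite exprS memvM.
by rewrite (subvP (sub1_agenv X)) ?memv_line.
Qed.

Lemma trace_orth_commutatorX X y h k : h \in agenv X ->
  trace_orth X (commutator y h) -> trace_orth X (commutator y (h ^+ k)).
Proof.
move=> Xh yh; elim: k => [|k IHk] w Xw.
  by rewrite expr0 /commutator mulr1 mul1r subrr mul0r mxtrace0.
rewrite exprS commutatorMr mulrDl mxtraceD.
rewrite -mulrA yh ?add0r; last first.
  exact: memvM (memvXn k Xh) Xw.
by rewrite -!mulrA -mulmxE mxtrace_mulC mulmxE -mulrA IHk ?memvM.
Qed.

(** For [h] in [H] and [w] in [agenv X], the product [h * w] lies in the ideal
    generated by [H], so it is nilpotent and has trace zero. *)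
Lemma trace_orth_nilpotent_ideal X H m : normalized_by X H -> (H ^+ m = 0)%VS ->
  {in H, forall h, trace_orth X h}.
Proof.
move=> nXH Hm0 h Hh w Xw; apply: (@mxtrace_nilpotent _ _ _ m).
apply/eqP; rewrite -memv0.
have /subvP -> // : (<[h * w]> ^+ m <= 0)%VS.
  rewrite -(prod0v (agenv X)) -Hm0 (subv_trans _ (expv_normalized _ nXH)) //.
  by apply: expvS; rewrite -memvE memv_mul.
by rewrite expv_line memv_line.
Qed.

(** Since [tr ([x, y] w) = tr (x [y, w])] and [h] is a sum of such [[x, y]], the
    trace of [h ^+ k.+1] is a sum of traces [tr (x [y, h ^+ k])], which vanish
    by hypothesis: [h] is nilpotent.  By Engel's theorem [H] then has a
    vanishing power, as the previous lemma requires. *)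
Lemma trace_orth_ideal X Y H : normalized_by X H -> (H <= X)%VS ->
  (H <= commv X Y)%VS ->
  {in Y & H, forall y h, trace_orth X (commutator y h)} ->
  {in H, forall h, trace_orth X h}.
Proof.
move=> nXH /subvP sHX /subvP sHXY orthYH.
have sXG := subvP (sub_agenv X).
have [|h Hh|m Hm0] := @engel _ _ H; last exact: trace_orth_nilpotent_ideal Hm0.
  by move=> x y /sHX Xx Hy; apply: nXH.
exists n.+1; apply: nilpotent_mxtraceX => k; rewrite exprS.
have : h \in commv X Y by exact: sHXY.
have XG_h := sXG _ (sHX _ Hh).
apply: (@commv_ind _ _ (fun z => \tr (z * h ^+ k) = 0)).
- by rewrite mul0r mxtrace0.
- by move=> a x y x0 y0; rewrite mulrDl -scalerAl mxtraceD mxtraceZ x0 y0 mulr0 addr0.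
move=> x y Xx Yy; rewrite mxtrace_commutator -mulmxE mxtrace_mulC.
by apply: trace_orth_commutatorX; [| exact: orthYH | exact: sXG].
Qed.

(** Descending induction along the derived series.  If [[D, D]] is
    trace-orthogonal, [trace_orth_ideal] gives the orthogonality of [[X, D]],
    because [[D, [X, D]]] is contained in [[D, D]]; and it then gives that of
    [D], because [[X, D]] is now known to be orthogonal. *)
Lemma trace_orth_dercommv X m : normalized_by X X -> dercommv X m = 0%VS ->
  {in commv X X, forall z, trace_orth X z}.
Proof.
move=> lieX Dm0.
suff H k : {in dercommv X (m - k).+1, forall z, trace_orth X z}.
  by have := H m; rewrite subnn.
elim: k => [|k IHk].
  move=> z /=; rewrite subn0 Dm0 commv0 memv0 => /eqP -> w _.
  by rewrite mul0r mxtrace0.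
(* For [k >= m] the truncated index [m - k] is [0] and nothing changes. *)
have [lemk|ltkm] := leqP m k.
  by move: IHk; rewrite subnS; move: lemk; rewrite -subn_eq0 => /eqP ->.
set D := dercommv X (m - k.+1).+1.
have {}IHk : {in commv D D, forall z, trace_orth X z}.
  by move: IHk; rewrite -(subnSK ltkm).
have nXD : normalized_by X D by apply: dercommv_normalized.
have sDX : (D <= X)%VS by apply: dercommv_sub.
have XD_orth : {in commv X D, forall z, trace_orth X z}.
  have sXD : (commv X D <= D)%VS by apply/commv_subP.
  apply: (@trace_orth_ideal X D) => //.
  - by move=> x z Xx /(subvP sXD) Dz; apply: memv_commv.
  - exact: subv_trans sDX.
  - by move=> y h Dy /(subvP sXD) Dh; apply: IHk; apply: memv_commv.
apply: (@trace_orth_ideal X X) => //.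
  by apply: commvS; apply: dercommv_sub.
by move=> y h Xy Dh; apply: XD_orth; apply: memv_commv.
Qed.

End SolvableTrace.

(** * Cartan's criterion for Lie algebras of matrices *)

Section CartanCriterion.
Variables (R : rcfType) (n : nat).
Let M := 'M[R]_n.+1.
Let MC := 'M[R[i]]_n.+1.
Let toC : M -> MC := map_mx (real_complex R).
Implicit Types (x y z : M) (X U : {vspace M}).

Definition complexify U : {vspace MC} := <<[seq toC b | b <- vbasis U]>>%VS.

Lemma memv_complexify U z : z \in U -> toC z \in complexify U.
Proof.
move=> /coord_vbasis ->; rewrite /toC raddf_sum memv_suml // => i _ /=.
rewrite map_mxZ memvZ // memv_span //.
by apply: map_f; rewrite mem_nth ?size_tuple.
Qed.

Let toC_commutator x y : toC (commutator x y) = commutator (toC x) (toC y).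
Proof. by rewrite /commutator /toC rmorphB !rmorphM. Qed.

Lemma complexify_ind U (P : MC -> Prop) : P 0 ->
  (forall a (x y : MC), P x -> P y -> P (a *: x + y)) ->
  {in U, forall x, P (toC x)} -> {in complexify U, forall z : MC, P z}.
Proof.
move=> P0 Plin PU; apply: span_ind => // w /mapP [b /vbasis_mem Ub ->]; exact: PU.
Qed.

(** Let [y] be the conjugate part of [x] in [[X, X]].  Like [x], it maps the
    complexification of [X] to that of [[X, X]] by commutation.  Hence
    [tr ([a, b] y) = tr (a [b, y])] is, up to sign, a value of [tr (a z)] with
    [z] in the complexification of [[X, X]], so it is zero by hypothesis; and [x]
    is a sum of such [[a, b]], so that [tr (x y) = 0]. *)
Lemma commv_nilpotent X : normalized_by X X ->
  (forall x y z, x \in X -> y \in X -> z \in X -> \tr (commutator x y * z) = 0) ->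
  {in commv X X, forall x, x ^+ n.+1 = 0}.
Proof.
move=> lieX trX x Dx.
have sDX : (commv X X <= X)%VS by apply/commv_subP.
have [y yBA tr_nil] := exists_conjugate_part (toC x).
suff /tr_nil : \tr (toC x * y) = 0.
  by rewrite -rmorphXn -(rmorph0 (@map_mx _ _ (real_complex R) n.+1 n.+1)) => /map_mx_inj.
have {}yBA : {in complexify X, forall b, commutator y b \in complexify (commv X X)}.
  apply: yBA.
    apply/subvP; apply: complexify_ind => [|a u v Xu Xv|u Du]; first exact: mem0v.
      by rewrite memvD ?memvZ.
    by rewrite memv_complexify ?(subvP sDX).
  apply: (@complexify_ind X (fun b => commutator (toC x) b \in complexify (commv X X))).
  - by rewrite /commutator mulr0 mul0r subrr mem0v.
  - by move=> a u v xu xv; rewrite commutatorDr commutatorZr; apply: memvD => //; apply: memvZ.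
  - move=> u Xu; rewrite -toC_commutator; apply: memv_complexify.
    by apply: memv_commv => //; apply: (subvP sDX).
move: x Dx {tr_nil}; apply: (@commv_ind _ _ (fun x => \tr (toC x * y) = 0)).
- by rewrite /toC raddf0 mul0r mxtrace0.
- move=> a u v u0 v0.
  by rewrite /toC raddfD /= map_mxZ mulrDl -scalerAl mxtraceD mxtraceZ u0 v0 mulr0 addr0.
move=> a b Xa Xb; rewrite toC_commutator mxtrace_commutator.
rewrite commutatorN mulrN linearN /= -mulmxE mxtrace_mulC mulmxE.
suff H : {in complexify (commv X X), forall z : MC, \tr (z * toC a) = 0}.
  by rewrite H ?oppr0 // yBA ?memv_complexify.
apply: complexify_ind => [|c u v u0 v0|].
- by rewrite mul0r mxtrace0.
- by rewrite mulrDl -scalerAl mxtraceD mxtraceZ u0 v0 mulr0 addr0.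
apply: commv_ind => [|c u v u0 v0|u v Xu Xv].
- by rewrite /toC raddf0 mul0r mxtrace0.
- by rewrite /toC raddfD /= map_mxZ mulrDl -scalerAl mxtraceD mxtraceZ u0 v0 mulr0 addr0.
by rewrite -rmorphM trace_map_mx trX // rmorph0.
Qed.

Theorem cartan_criterion X : normalized_by X X ->
  (exists m, dercommv X m = 0%VS) <->
  (forall x y z, x \in X -> y \in X -> z \in X -> \tr (commutator x y * z) = 0).
Proof.
move=> lieX; split=> [[m Dm0] x y z Xx Xy Xz|trX].
  apply: (trace_orth_dercommv lieX Dm0 (memv_commv Xx Xy)).
  exact: (subvP (sub_agenv X)).
have lieD : normalized_by (commv X X) (commv X X).
  move=> x y /(subvP (dercommv_sub 1 lieX)) Xx Dy; exact: commv_normalized Xx Dy.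
have [|m Dm0] := engel lieD.
  by move=> x Dx; exists n.+1; exact: (commv_nilpotent lieX trX).
exists m.+1; apply/eqP; rewrite -subv0.
rewrite (subv_trans (dercommv_sub_expv m lieX)) //.
by rewrite expvSl Dm0 prodv0.
Qed.

End CartanCriterion.

(** * Leibniz algebras and their quotient by Leib *)

Local Open Scope classical_set_scope.
Local Open Scope ring_scope.

Section Leibniz.
Variables (R : realType) (g : vectType R) (mul : {bilinear g -> g -> g}).
Hypothesis mulP : left_leibniz mul.
Implicit Types (u v w : g) (I J : {vspace g}) (f h : 'End(g)).

Local Notation Leib := (Leib mul).
Local Notation L := (Lmul mul).
Local Notation Rm := (Rmul mul).
Local Notation K := (leibK mul).

Lemma mul_commutator u v w : mul (mul u v) w = mul u (mul v w) - mul v (mul u w).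
Proof. by rewrite mulP addrK. Qed.

Lemma mem_Leib u v : mul u v + mul v u \in Leib.
Proof.
have [sub _] := set_spanP [set x | exists u v, x = mul u v + mul v u].
by apply: sub; exists u, v.
Qed.

Lemma Leib_sub (U : {vspace g}) : (forall u v, mul u v + mul v u \in U) -> (Leib <= U)%VS.
Proof.
move=> symU; have [_ min] := set_spanP [set x | exists u v, x = mul u v + mul v u].
by apply: min => _ [u [v ->]]; apply: symU.
Qed.

Lemma mul_Leib0 x v : x \in Leib -> mul x v = 0.
Proof.
move=> xLeib; have /subvP/(_ x xLeib) : (Leib <= lker (Rm v))%VS.
  apply: Leib_sub => a b; rewrite memv_ker RmulE linearDl /= !mul_commutator.
  by rewrite addrA subrK subrr.
by rewrite memv_ker RmulE => /eqP.
Qed.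

Lemma ideal_Leib : ideal mul Leib.
Proof.
move=> u x xLeib; rewrite (mul_Leib0 _ xLeib) mem0v; split=> //.
have /subvP/(_ x xLeib) : (Leib <= L u @^-1: Leib)%VS.
  apply: Leib_sub => a b; rewrite -memv_preim LmulE linearDr /= (mulP u a b) (mulP u b a).
  by rewrite [mul (mul u b) a + _]addrC addrACA memvD ?mem_Leib.
by rewrite -memv_preim LmulE.
Qed.

Lemma solvable_Leib : solvable mul Leib.
Proof.
exists 1%N; apply/eqP; rewrite -subv0; apply/prod_space_subP => u v Lu _.
by rewrite mul_Leib0 ?mem0v.
Qed.

(** The image of [P] is a copy of [g / Leib]; by [PLP], compressing the [L u]
    to it respects their products. *)
Let P : 'End(g) := (\1 - projv Leib)%VF.

Let P_sub v : v - P v \in Leib.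
Proof. by rewrite add_lfunE opp_lfunE id_lfunE opprB addrC subrK memv_proj. Qed.

Let P_eq0 v : (P v == 0) = (v \in Leib).
Proof.
apply/eqP/idP => [Pv0|vL]; first by rewrite -[v]subr0 -Pv0.
by rewrite add_lfunE opp_lfunE id_lfunE projv_id // subrr.
Qed.

Let P_congr u v : u - v \in Leib -> P u = P v.
Proof. by rewrite -P_eq0 linearB subr_eq0 => /eqP. Qed.

Let PLP u v : P (mul u (P v)) = P (mul u v).
Proof. by apply: P_congr; rewrite -linearB -memvN -linearN opprB /= (ideal_Leib u (P_sub v)).1. Qed.

Definition tomx f : 'M[R]_(\dim {:g}) := passmx.mxof (vbasis {:g}) (vbasis {:g}) f.

Lemma tomx_is_linear : linear tomx. Proof. exact: passmx.mxof_linear. Qed.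
HB.instance Definition _ := GRing.isLinear.Build R 'End(g) _ _ tomx tomx_is_linear.

Lemma tomx_comp f h : tomx (f \o h)%VF = tomx h *m tomx f.
Proof. exact: passmx.mxof_comp (vbasisP _) _ _. Qed.

Lemma tomx_eq0 f : tomx f = 0 -> f = 0.
Proof. by move/eqP; rewrite passmx.mxof_eq0 ?vbasisP // => /eqP. Qed.

Lemma lftraceE f : lftrace f = \tr (tomx f). Proof. by []. Qed.

Lemma lftraceC f h : lftrace (f \o h)%VF = lftrace (h \o f)%VF.
Proof. by rewrite !lftraceE !tomx_comp mxtrace_mulC. Qed.

Definition qad u : 'End(g) := (P \o L u)%VF.

Let qadE u v : qad u v = P (mul u v).
Proof. by rewrite comp_lfunE LmulE. Qed.

(** The sign makes [mxad] a representation: matrices act on row vectors, so that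
    [tomx] reverses products. *)
Definition mxad u : 'M[R]_(\dim {:g}) := - tomx (qad u).

Lemma mxad_is_linear : linear mxad.
Proof.
move=> a u v; rewrite /mxad; have -> : qad (a *: u + v) = a *: qad u + qad v.
  by apply/lfunP=> w; rewrite add_lfunE scale_lfunE !qadE linearPl linearP.
by rewrite linearP opprD scalerN.
Qed.
HB.instance Definition _ := GRing.isLinear.Build R g _ _ mxad mxad_is_linear.

Lemma mxad_mul u v : mxad (mul u v) = mxad u *m mxad v - mxad v *m mxad u.
Proof.
rewrite /mxad !mulNmx !mulmxN !opprK -!tomx_comp -linearB -linearN.
congr (tomx _); apply/lfunP => w.
rewrite opp_lfunE add_lfunE opp_lfunE !(comp_lfunE (qad _) (qad _)) !qadE.
by rewrite !PLP mul_commutator linearB opprB.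
Qed.

Lemma mxad_eq0 u : mxad u = 0 <-> forall v, mul u v \in Leib.
Proof.
have -> : mxad u = 0 <-> qad u = 0.
  split=> [/eqP|u0]; last by rewrite /mxad u0 linear0 oppr0.
  by rewrite oppr_eq0 => /eqP /tomx_eq0.
split=> [u0 v|uL]; first by rewrite -P_eq0 -qadE u0 zero_lfunE.
by apply/lfunP => v; rewrite qadE zero_lfunE; apply/eqP; rewrite P_eq0.
Qed.

(** In [tr (L_a R_b)] both factors can be restricted to the copy of [g / Leib],
    since [R_b] kills Leib and [L_a] preserves it; there [R_b = - L_b]. *)
Lemma mxtrace_mxad u v : \tr (mxad u *m mxad v) = K u v.
Proof.
have tr_mxad a b : \tr (mxad a *m mxad b) = lftrace (qad a \o qad b)%VF.
  by rewrite lftraceC /mxad mulNmx mulmxN opprK -tomx_comp.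
have tr_LR a b : lftrace (L a \o Rm b)%VF = - \tr (mxad a *m mxad b).
  have -> : (L a \o Rm b)%VF = ((L a \o Rm b) \o P)%VF.
    apply/lfunP => w; rewrite !comp_lfunE !LmulE !RmulE; congr (mul a _).
    by apply/eqP; rewrite -subr_eq0 -linearBl mul_Leib0 ?P_sub.
  rewrite lftraceC.
  have -> : (P \o (L a \o Rm b))%VF = (- (qad a \o qad b))%VF.
    apply/lfunP => w; rewrite opp_lfunE !comp_lfunE !LmulE RmulE PLP.
    apply/eqP; rewrite -addr_eq0 -linearD -linearDr P_eq0.
    by apply: (ideal_Leib _ _).1; apply: mem_Leib.
  by rewrite tr_mxad !lftraceE !linearN.
rewrite /leibK !tr_LR [\tr (mxad v *m _)]mxtrace_mulC.
by set t := \tr _; lra.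
Qed.

(** The element [a (x (a v))] lies in [I I], hence [ad a ad x ad a = 0] on
    [g / Leib]. *)
Lemma mxad_abelian_trace0 I a x : ideal mul I -> (prod_space mul I I <= Leib)%VS ->
  a \in I -> \tr (mxad a *m mxad x) = 0.
Proof.
move=> idI /prod_space_subP abI aI.
have axa : mxad a *m mxad x *m mxad a = 0.
  rewrite /mxad !(mulNmx, mulmxN) -!tomx_comp -[RHS]oppr0; congr (- _).
  rewrite opprK; suff -> : (qad a \o (qad x \o qad a))%VF = 0 by rewrite linear0.
  apply/lfunP => v; rewrite zero_lfunE !(comp_lfunE (qad _)) !qadE.
  rewrite (PLP x) (PLP a); apply/eqP; rewrite P_eq0.
  by apply: abI => //; apply: (idI _ _ _).1; apply: (idI _ _ _).2.
apply: (@mxtrace_nilpotent _ _ _ 2).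
by rewrite expr2 -mulmxE mulmxA axa mul0mx.
Qed.

Lemma leibK_linear a x y z : K (a *: x + y) z = a * K x z + K y z.
Proof. by rewrite -!mxtrace_mxad linearP mulmxDl -scalemxAl mxtraceD mxtraceZ. Qed.

Lemma leibK_mulC u v w : K (mul u v) w = K u (mul v w).
Proof.
rewrite -!mxtrace_mxad !mxad_mul mulmxBl mulmxBr !linearB /= !mulmxA; congr (_ - _).
by rewrite -(mulmxA (mxad v)) mxtrace_mulC.
Qed.

Lemma exists_kerK : exists U : {vspace g}, forall x, x \in U <-> kerK mul x.
Proof.
have K0 y : K 0 y = 0 by rewrite -mxtrace_mxad linear0 mul0mx mxtrace0.
have [|U UK maxU] := @exists_max_subspace _ g (fun U => forall x, x \in U -> kerK mul x) 0%VS.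
  by move=> x; rewrite memv0 => /eqP -> y; apply: K0.
exists U => x; split=> [/UK //|xK].
have <- : (U + <[x]>)%VS = U.
  apply: maxU; last exact: addvSl.
  move=> _ /memv_addP [u /UK uK [_ /vlineP [a ->] ->]] y.
  by rewrite addrC leibK_linear uK xK mulr0 addr0.
by rewrite (subvP (addvSr _ _)) ?memv_line.
Qed.

(** The invariance [K (u v, w) = K (u, v w)] and the symmetry of [K] move every
    product away from the kernel element. *)
Lemma kerK_ideal (U : {vspace g}) : (forall x, x \in U <-> kerK mul x) -> ideal mul U.
Proof.
move=> UK u x /UK xK; split; apply/UK => y.
  by rewrite leibK_mulC leibKC leibK_mulC xK.
by rewrite leibK_mulC xK.
Qed.

Lemma dercommv_img n' (rho : {linear g -> 'M[R]_n'.+1}) I k :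
  (forall u v, rho (mul u v) = commutator (rho u) (rho v)) ->
  dercommv (linfun rho @: I)%VS k = (linfun rho @: derived mul I k)%VS.
Proof.
move=> rho_mul; elim: k => //= k ->; set D := derived mul I k.
apply/eqP; rewrite eqEsubv; apply/andP; split.
  apply/commv_subP => _ _ /memv_imgP [u Du ->] /memv_imgP [v Dv ->].
  by rewrite !lfunE /= -rho_mul -[rho _]lfunE memv_img // mem_prod_space.
apply/subvP => _ /memv_imgP [x Dx ->].
suff /subvP/(_ x Dx) : (prod_space mul D D <=
    linfun rho @^-1: commv (linfun rho @: D) (linfun rho @: D))%VS.
  by rewrite -memv_preim.
apply/prod_space_subP => u v Du Dv; rewrite -memv_preim lfunE /= rho_mul.
by apply: memv_commv; rewrite -lfunE memv_img.
Qed.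

(** Cartan's criterion carried over along [rho].  The case [n = 0] is apart, as
    the matrices of size [0] form a trivial ring, not an associative algebra
    with [1 != 0]. *)
Lemma solvable_trace n (rho : {linear g -> 'M[R]_n}) I :
  (forall u v, rho (mul u v) = rho u *m rho v - rho v *m rho u) ->
  {in I &, forall u v, mul u v \in I} ->
  (exists k, {in derived mul I k, forall u, rho u = 0}) <->
  (forall u v w, u \in I -> v \in I -> w \in I -> \tr (rho (mul u v) *m rho w) = 0).
Proof.
case: n rho => [|n] rho rho_mul mulI.
  split=> _; first by move=> *; rewrite /mxtrace big_ord0.
  by exists 0%N => u _; apply/matrixP => -[].
set X := (linfun rho @: I)%VS.
have Xrho u : u \in I -> rho u \in X by rewrite -[rho u]lfunE => /memv_img ->.
have lieX : normalized_by X X.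
  move=> _ _ /memv_imgP [u Iu ->] /memv_imgP [v Iv ->].
  by rewrite !lfunE /= /commutator -!mulmxE -rho_mul Xrho ?mulI.
have DE k := @dercommv_img _ rho I k rho_mul.
split=> [[k Dk0]|trI].
  have /(cartan_criterion lieX) trX : exists k, dercommv X k = 0%VS.
    exists k; rewrite DE; apply/eqP; rewrite -subv0; apply/subvP => _ /memv_imgP [u Du ->].
    by rewrite lfunE /= Dk0 ?mem0v.
  by move=> u v w Iu Iv Iw; rewrite rho_mul trX ?Xrho.
have /(cartan_criterion lieX) [k Dk0] : forall x y z, x \in X -> y \in X -> z \in X ->
    \tr (commutator x y * z) = 0.
  move=> _ _ _ /memv_imgP [u Iu ->] /memv_imgP [v Iv ->] /memv_imgP [w Iw ->].
  by rewrite !lfunE /= /commutator -!mulmxE -rho_mul trI.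
exists k => u Du; apply/eqP; rewrite -memv0 -Dk0 DE -[rho u]lfunE.
exact: memv_img.
Qed.

(** The criterion for [mxad] concerns the derived algebras up to the kernel of
    [mxad]; but if [mxad] kills one of them, then the next one is contained in
    Leib and the one after it is zero. *)
Lemma solvable_leibK I : {in I &, forall u v, mul u v \in I} ->
  solvable mul I <->
  (forall u v w, u \in I -> v \in I -> w \in I -> K (mul u v) w = 0).
Proof.
move=> mulI; have solE := solvable_trace mxad_mul mulI.
split=> [[k Dk0] u v w Iu Iv Iw|K0].
  rewrite -mxtrace_mxad; apply: solE.1 => //; exists k => x.
  by rewrite Dk0 memv0 => /eqP ->; rewrite linear0.
have [|k rho0] := solE.2.
  by move=> u v w Iu Iv Iw; rewrite mxtrace_mxad K0.
have D1 : (derived mul I k.+1 <= Leib)%VS.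
  by apply/prod_space_subP => u v /rho0 /mxad_eq0 uL _.
exists k.+2; apply/eqP; rewrite -subv0; apply/prod_space_subP => u v Du _.
by rewrite mul_Leib0 ?mem0v ?(subvP D1).
Qed.

Lemma Leib_kerK x : x \in Leib -> kerK mul x.
Proof.
move=> xL y; rewrite -mxtrace_mxad (_ : mxad x = 0) ?mul0mx ?mxtrace0 //.
by apply/mxad_eq0 => v; rewrite mul_Leib0 ?mem0v.
Qed.

Lemma ideal_derived I k : ideal mul I -> ideal mul (derived mul I k).
Proof.
move=> idI; elim: k => //= k IHk u x; set D := derived mul I k in IHk *.
suff H : (prod_space mul D D <= L u @^-1: prod_space mul D D)%VS /\
         (prod_space mul D D <= Rm u @^-1: prod_space mul D D)%VS.
  move=> Dx; have [/subvP/(_ x Dx) + /subvP/(_ x Dx)] := H.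
  by rewrite -!memv_preim LmulE RmulE.
split; apply/prod_space_subP => a b Da Db; rewrite -memv_preim ?LmulE ?RmulE.
  by rewrite mulP; apply: memvD; apply: mem_prod_space => //; apply: (IHk _ _ _).1.
rewrite mul_commutator; apply: memvB; apply: mem_prod_space => //; exact: (IHk _ _ _).2.
Qed.

(** The last derived ideal of [J] outside Leib would be abelian modulo Leib,
    hence in the kernel of [K] by [mxad_abelian_trace0]. *)
Lemma solvable_ideal_sub J : (forall x, kerK mul x -> x \in Leib) ->
  ideal mul J -> solvable mul J -> (J <= Leib)%VS.
Proof.
move=> kerL idJ [m Jm0].
have : (derived mul J m <= Leib)%VS by rewrite Jm0 sub0v.
elim: m {Jm0} => // m IHm Dm; apply: IHm; apply/subvP => a Da.
apply: kerL => x; rewrite -mxtrace_mxad.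
exact: (mxad_abelian_trace0 x (ideal_derived idJ) Dm Da).
Qed.

End Leibniz.

Theorem proposition2p3 (R : realType) (g : vectType R)
    (mul : {bilinear g -> g -> g}) (mul_leibniz : left_leibniz mul) :
  (semisimple mul <-> kerK mul = [set` Leib mul]) /\
  (solvable mul {:g}%VS <-> [set` prod_space mul {:g}%VS {:g}%VS] `<=` kerK mul).
Proof.
have [U UK] := exists_kerK mul_leibniz.
have mulf : {in {:g}%VS &, forall u v, mul u v \in {:g}%VS}.
  by move=> *; rewrite memvf.
split; split.
- move=> ssg; apply/seteqP; split=> x /=; last exact: Leib_kerK.
  have idU := kerK_ideal mul_leibniz UK.
  have [_ _ maxrad] := radicalP mul.
  move=> /UK; rewrite -ssg; apply/subvP: x; apply: maxrad => //.
  apply: (solvable_leibK mul_leibniz _).2 => [u v _ /(idU u) []//|u v w _ _ /UK wK].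
  by rewrite leibKC.
- move=> kerE; apply: radical_eq; split.
  + exact: ideal_Leib.
  + exact: solvable_Leib.
  + by move=> J; apply: solvable_ideal_sub => // x; rewrite kerE.
- move=> solg; have sub : (prod_space mul {:g} {:g} <= U)%VS.
    apply/prod_space_subP => u v _ _; apply/UK => w.
    by apply: (solvable_leibK mul_leibniz mulf).1; rewrite ?memvf.
  by move=> x /= /(subvP sub) /UK.
move=> sub; apply: (solvable_leibK mul_leibniz mulf).2 => u v w _ _ _.
by apply: sub; apply: mem_prod_space; apply: memvf.
Qed.
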